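(* Let $k\ge 1$, let $\pi_\beta$ be a strictly positive, continuously differentiable density on $\mathbb{R}^k$ that is exponentially light. Let $R\ge 0$ and $p>2$, define $f:[0,\infty)\to[0,\infty)$ by $f(x)=x$ for $x<R$ and $f(x)=x+(x-R)^p$ for $x\ge R$, and define $h:\mathbb{R}^k\to\mathbb{R}^k$ by $h(\gamma)=f(|\gamma|)\,\gamma/|\gamma|$ for $\gamma\ne 0$ and $h(0)=0$. Then the density $$\pi_\gamma(\gamma)=\pi_\beta\bigl(h(\gamma)\bigr)\,\bigl|\det\nabla h(\gamma)\bigr|,\qquad \gamma\in\mathbb{R}^k,$$ is super-exponentially light.
   Context: $|\cdot|$ denotes the Euclidean norm on $\mathbb{R}^k$, and $\cdot$ between vectors the inner product. Densities are with respect to Lebesgue measure. $\nabla h(\gamma)$ is the Jacobian matrix of $h$. For a strictly positive continuously differentiable density $\pi$ on $\mathbb{R}^k$ consider $$L(\pi)=\limsup_{|x|\to\infty}\frac{x}{|x|}\cdot\nabla\log\pi(x)\in[-\infty,\infty].$$ $\pi$ is called super-exponentially light if $L(\pi)=-\infty$, exponentially light if $L(\pi)<0$ (the value $-\infty$ is allowed), and sub-exponentially light if $L(\pi)=0$. *)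

(* Defs.v *)
From HB Require Import structures.
From mathcomp Require Import all_boot all_order all_algebra.
From mathcomp Require Import all_classical all_reals all_analysis.

Set Implicit Arguments.
Unset Strict Implicit.
Unset Printing Implicit Defensive.

Import Order.TTheory GRing.Theory Num.Theory.
Import numFieldNormedType.Exports.

Local Open Scope classical_set_scope.
Local Open Scope ring_scope.

Section lebesgue_tuple.
Context {R : realType}.

Definition cons_pair n (xt : R * n.-tuple R) : n.+1.-tuple R :=
  [tuple of xt.1 :: xt.2].

(* Lebesgue measure on R^n: the n-fold product of the one-dimensional one.   *)
Fixpoint lebesgue_tuple n : set (n.-tuple R) -> \bar R :=
  match n with
  | 0 => \d_([tuple] : 0.-tuple R)
  | m.+1 => pushforward (lebesgue_measure \x @lebesgue_tuple m)%E (@cons_pair m)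
  end.

Lemma measurable_cons_pair n : measurable_fun [set: R * n.-tuple R] (@cons_pair n).
Proof. exact: measurable_cons. Qed.

Definition uncons n (t : n.+1.-tuple R) : R * n.-tuple R :=
  (thead t, [tuple of behead t]).

Lemma measurable_uncons n : measurable_fun [set: n.+1.-tuple R] (@uncons n).
Proof.
apply/measurable_fun_pairP; split; last exact: measurable_behead.
exact: (@measurable_tnth _ _ n.+1 ord0).
Qed.

Lemma cons_pairK n : cancel (@cons_pair n) (@uncons n).
Proof.
move=> [x t]; rewrite /uncons /cons_pair /=; congr (_, _).
by apply: val_inj.
Qed.

Lemma unconsK n : cancel (@uncons n) (@cons_pair n).
Proof. by move=> t; rewrite /cons_pair/=; rewrite [RHS]tuple_eta. Qed.


Lemma lebesgue_tuple_measureP n :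
  exists m : {sigma_finite_measure set (n.-tuple R) -> \bar R},
    m = @lebesgue_tuple n :> (set (n.-tuple R) -> \bar R).
Proof.
elim: n => [|n [m mE]]; first by exists (\d_([tuple] : 0.-tuple R)).
pose mu : {measure set _ -> \bar R} := (@lebesgue_measure R \x m)%E.
have muE : @lebesgue_tuple n.+1 = pushforward mu (@cons_pair n).
  by rewrite /mu /= mE.
have mpre (A : set (n.+1.-tuple R)) :
    measurable A -> measurable (@cons_pair n @^-1` A).
  by move=> mA; rewrite -[X in measurable X]setTI; exact: measurable_cons_pair.
have H0 : @lebesgue_tuple n.+1 set0 = 0%E.
  by rewrite muE /pushforward preimage_set0 measure0.
have Hge0 A : (0 <= @lebesgue_tuple n.+1 A)%E.
  by rewrite muE /pushforward; exact: measure_ge0.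
have Hadd : semi_sigma_additive (@lebesgue_tuple n.+1).
  move=> F mF tF mUF; rewrite muE /pushforward preimage_bigcup.
  apply: measure_semi_sigma_additive.
  - by move=> i; exact: mpre.
  - apply/trivIsetP => /= i j _ _ ij; rewrite -preimage_setI.
    by move/trivIsetP : tF => /(_ _ _ _ _ ij) ->//; rewrite preimage_set0.
  - by rewrite -preimage_bigcup; exact: mpre.
have Hfin : sigma_finite setT (@lebesgue_tuple n.+1).
  have [F FT Foo] : sigma_finite setT mu.
    have /sigma_finiteP[F [TF ndF Foo]] := sigma_finiteT (@lebesgue_measure R).
    have /sigma_finiteP[G [TG ndG Goo]] := sigma_finiteT m.
    exists (fun i => F i `*` G i).
      rewrite -setXTT TF TG predeqE => -[x y]; split.
        move=> [/= [i _ Fix] [j _ Gjy]]; exists (maxn i j) => //; split.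
        - by move: x Fix; exact/subsetPset/ndF/leq_maxl.
        - by move: y Gjy; exact/subsetPset/ndG/leq_maxr.
      by move=> [i _ []/= ? ?]; split; exists i.
    move=> i; have [? ?] := Foo i; have [? ?] := Goo i.
    split; first exact: measurableX.
    by rewrite /mu /= product_measure1E// lte_mul_pinfty// ge0_fin_numE.
  exists (fun i => @uncons n @^-1` F i).
    by rewrite -preimage_bigcup -FT preimage_setT.
  move=> i; have [mFi Fioo] := Foo i; split.
    by rewrite -[X in measurable X]setTI; exact: measurable_uncons.
  rewrite muE /pushforward -comp_preimage.
  rewrite (_ : _ \o _ = id); first by rewrite preimage_id.
  by apply/funext => x /=; rewrite cons_pairK.
pose M1 := isMeasure.Build _ _ _ (@lebesgue_tuple n.+1) H0 Hge0 Hadd.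
pose M : {measure set (n.+1.-tuple R) -> \bar R} :=
  HB.pack (@lebesgue_tuple n.+1) M1.
pose S1 := isSFinite.Build _ _ _ M (@sfinite_measure_sigma_finite _ _ _ M Hfin).
pose S2 := isSigmaFinite.Build _ _ _ M Hfin.
pose S := HB.pack_for (SigmaFiniteMeasure.type _ R) (Measure.sort M) S1 S2.
by exists S.
Qed.

Let lebesgue_tuple0 n : @lebesgue_tuple n set0 = 0%E.
Proof. by have [m <-] := lebesgue_tuple_measureP n; exact: measure0. Qed.

Let lebesgue_tuple_ge0 n A : (0 <= @lebesgue_tuple n A)%E.
Proof. by have [m <-] := lebesgue_tuple_measureP n; exact: measure_ge0. Qed.

Let lebesgue_tuple_semi_sigma_additive n :
  semi_sigma_additive (@lebesgue_tuple n).
Proof.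
have [m <-] := lebesgue_tuple_measureP n.
exact: measure_semi_sigma_additive.
Qed.

HB.instance Definition _ n := isMeasure.Build _ _ _ (@lebesgue_tuple n)
  (lebesgue_tuple0 n) (@lebesgue_tuple_ge0 n)
  (@lebesgue_tuple_semi_sigma_additive n).

Let lebesgue_tuple_sigma_finite n : sigma_finite setT (@lebesgue_tuple n).
Proof. by have [m <-] := lebesgue_tuple_measureP n; exact: sigma_finiteT. Qed.

HB.instance Definition _ n := Measure_isSigmaFinite.Build _ _ _
  (@lebesgue_tuple n) (lebesgue_tuple_sigma_finite n).

Lemma lebesgue_tuple_box n (A : 'I_n -> set R) :
  (forall i, measurable (A i)) ->
  @lebesgue_tuple n [set t | forall i, A i (tnth t i)] =
  (\prod_(i < n) lebesgue_measure (A i))%E.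
Proof.
elim: n A => [|n IH] A mA.
  by rewrite big_ord0 /= diracE mem_set//= => -[].
rewrite big_ord_recl -IH// /= /pushforward.
have mB : measurable [set t : n.-tuple R | forall i, A (lift ord0 i) (tnth t i)].
  rewrite (_ : [set _ | _] = \bigcap_(i in [set: 'I_n]) ((@tnth n R)^~ i @^-1` A (lift ord0 i))).
    apply: fin_bigcap_measurable => // i _.
    by rewrite -[X in measurable X]setTI; exact: measurable_tnth.
  by apply/seteqP; split => [t/= h i _|t/= h i]; exact: h.
rewrite -(product_measure1E (@lebesgue_measure R) (@lebesgue_tuple n))//.
congr (product_measure1 _ _ _); apply/seteqP; split => -[x t] /=.
  move=> h; split; first exact: (h ord0).
  by move=> i; have := h (lift ord0 i); rewrite tnthS.
move=> [hx ht] i; case: (unliftP ord0 i) => [j|] ->; last exact: hx.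
by rewrite tnthS; exact: ht.
exact: mA.
Qed.

End lebesgue_tuple.
Arguments lebesgue_tuple {R} n.

Section euclidean.
Context {R : realType} {k : nat}.
Implicit Types (u v x : 'rV[R]_k) (g : 'rV[R]_k -> R).

Definition dotv u v : R := \sum_(i < k) u ord0 i * v ord0 i.

(* The norm `|u| carried by 'rV[R]_k is the sup norm, which induces the same
   topology and hence the same differentials, but is not the Euclidean norm. *)
Definition enorm u : R := Num.sqrt (dotv u u).

Definition enorm_infty : set_system 'rV[R]_k :=
  [set A | exists r : R, forall x, r < enorm x -> A x].

Definition grad g x : 'rV[R]_k := \row_(i < k) 'D_(delta_mx ord0 i) g x.

Definition C1 g := (forall x, differentiable g x) /\ continuous (grad g).

Definition rV_of_tuple (t : k.-tuple R) : 'rV[R]_k := \row_(i < k) tnth t i.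

(* Probability density w.r.t. Lebesgue measure; R^k carries its measurable
   structure as k.-tuple R and its topological one as 'rV[R]_k.              *)
Definition density g :=
  [/\ forall x, 0 <= g x,
      measurable_fun [set: k.-tuple R] (g \o rV_of_tuple) &
      (\int[lebesgue_tuple k]_t (g (rV_of_tuple t))%:E = 1)%E].

Definition positive_C1_density g :=
  [/\ density g, forall x, 0 < g x & C1 g].

Definition dlog_limsup g : \bar R :=
  limf_esup (fun x => (dotv ((enorm x)^-1 *: x) (grad (fun y => ln (g y)) x))%:E)
    enorm_infty.

Definition exponentially_light g := positive_C1_density g /\ (dlog_limsup g < 0)%E.

Definition super_exponentially_light g :=
  positive_C1_density g /\ dlog_limsup g = -oo%E.

End euclidean.

Section transformation.
Context {R : realType} {k : nat}.

Definition radial (R0 p x : R) : R :=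
  if x < R0 then x else x + (x - R0) `^ p.

Definition isotropic (f : R -> R) (gamma : 'rV[R]_k) : 'rV[R]_k :=
  if gamma == 0 then 0 else (f (enorm gamma) / enorm gamma) *: gamma.

(* 'J h acts on row vectors from the right, so it is the transpose of the
   usual Jacobian matrix; the determinant is unaffected.                     *)
Definition transformed_density (pi : 'rV[R]_k -> R)
    (h : 'rV[R]_k -> 'rV[R]_k) (gamma : 'rV[R]_k) : R :=
  pi (h gamma) * `| \det ('J h gamma) |.

End transformation.

(* Main.v *)
Require Import Defs.
From mathcomp Require Import all_boot all_order all_algebra.
From mathcomp Require Import all_classical all_reals all_analysis.
From mathcomp Require Import measurable_realfun ring lra.

Import Order.TTheory GRing.Theory Num.Theory.
Import numFieldNormedType.Exports.

Local Open Scope classical_set_scope.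
Local Open Scope ring_scope.
Set Implicit Arguments.
Unset Strict Implicit.
Unset Printing Implicit Defensive.

(** Write s = |x|, u = x / |x| and f s = s + (s - R0)_+^p.  The map h sends x to
    (f s / s) x, so everything about it is one-dimensional along rays: its
    Jacobian determinant is (f s / s)^(k-1) f' s ([det_radial_map]), and the
    radial derivative of the logarithm of the new density is

      f' s (u . grad log pi_beta (h x)) + f'' s / f' s + (k-1) (log (f s / s))'

    ([radial_dlog_transformed]).  Since pi_beta is exponentially light, the factor
    u . grad log pi_beta (h x) is at most some - d < 0 for large s, while f' s
    tends to infinity; the other two terms are bounded.  Hence the limsup is -oo
    ([dlog_limsup_transformed]).

    The rest of the work is to see that the new function is a continuously
    differentiable probability density.

    For differentiability, every radial function that occurs is a combination
    of the profiles (s - R0)_+^a / s^b.  Such a profile has a continuous gradient,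
    at the origin too, when b + 1 < a ([is_grad_profile],
    [continuous_grad_profile]).  The pairs in use are (p, 1) and (p - 1, 0), and
    this is where p > 2 enters.

    For the total mass, a change of variables in dimension k is needed, but only
    for a radial map.  The formula [ge0_integral_rays] writes an integral over R^k
    as an average of integrals of t^(k-1) F (t z) over rays.  Its proof uses
    Tonelli and the behaviour of Lebesgue measure under dilations
    ([ge0_integral_scale]), and no measure on the sphere.  On each ray the change
    of variables is the substitution of f in an integral over the half-line
    ([integral_ray]). *)

(** * Homogeneity of Lebesgue measure *)
Section scaling.
Context {R : realType}.
Notation mu := (@lebesgue_measure R).

Lemma ge0_integral_scale1 (c : R) (f : R -> \bar R) : 0 < c ->
  measurable_fun [set: R] f -> (forall x, 0 <= f x)%E ->
  (\int[mu]_x f x = c%:E * \int[mu]_x f (c * x)%R)%E.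
Proof.
move=> c0 mf f0.
pose h : measurableTypeR R -> measurableTypeR R := fun x => c * x.
have mc : measurable_fun [set: R] h by exact: mulrl_measurable.
have -> : (\int[mu]_x f (c * x)%R = \int[pushforward mu h]_x f x)%E.
  by rewrite ge0_integral_pushforward.
have -> : (c%:E = (NngNum (ltW c0))%:num%:E)%E by [].
rewrite -ge0_integral_mscale//=.
apply: eq_measure_integral => A mA _.
apply: (lebesgue_measure_unique
  (mu := mscale (NngNum (ltW c0)) (pushforward mu h))) => // _ [[a b] _ <-] /=.
rewrite /mscale/= /pushforward.
have -> : h @^-1` `]a, b] = `]a / c, b / c]%classic.
  by apply/seteqP; split => x /=; rewrite /h !in_itv/= ltr_pdivrMr// ler_pdivlMr// ![x * c]mulrC.
rewrite !lebesgue_measure_itv/= !lte_fin ltr_pM2r ?invr_gt0//.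
by case: ifPn; rewrite ?mule0// -!EFinD -EFinM => _; congr EFin; field; rewrite gt_eqF.
Qed.

Definition scale_tuple n (c : R) (t : n.-tuple R) : n.-tuple R :=
  [tuple c * tnth t i | i < n].

Lemma measurable_scale_tuple n :
  measurable_fun [set: R * n.-tuple R] (fun z => scale_tuple z.1 z.2).
Proof.
apply/measurable_fun_tnthP => i.
rewrite (_ : _ \o _ = (fun z => z.1 * tnth z.2 i)); last first.
  by apply/funext => z /=; rewrite tnth_mktuple.
apply: measurable_funM; first exact: measurable_fst.
exact: (measurableT_comp (measurable_tnth i) measurable_snd).
Qed.

Lemma measurable_scale_tupler n (c : R) : measurable_fun [set: n.-tuple R] (scale_tuple c).
Proof. exact: (measurableT_comp (@measurable_scale_tuple n) (pair1_measurable c)). Qed.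

Lemma ge0_integral_tupleS n (f : n.+1.-tuple R -> \bar R) :
  measurable_fun [set: n.+1.-tuple R] f -> (forall x, 0 <= f x)%E ->
  (\int[lebesgue_tuple n.+1]_t f t =
   \int[mu]_x \int[lebesgue_tuple n]_t f (cons_pair (x, t)))%E.
Proof.
move=> mf f0.
have mcp : measurable_fun [set: measurableTypeR R * n.-tuple R] (@cons_pair R n).
  exact: measurable_cons_pair.
rewrite [LHS](eq_measure_integral
  (pushforward (mu \x lebesgue_tuple n)%E (@cons_pair R n)))//.
rewrite ge0_integral_pushforward//.
rewrite preimage_setT.
have := @fubini_tonelli1 _ _ (measurableTypeR R) _ R mu (lebesgue_tuple n)
  (f \o @cons_pair R n).
apply; last by move=> x; exact: f0.
exact: (measurableT_comp mf mcp).
Qed.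

Lemma measurable_integral_cons n (f : n.+1.-tuple R -> \bar R) :
  measurable_fun [set: n.+1.-tuple R] f -> (forall x, 0 <= f x)%E ->
  measurable_fun [set: R]
    (fun x => \int[lebesgue_tuple n]_t f (cons_pair (x, t)))%E.
Proof.
move=> mf f0.
have := @measurable_fun_fubini_tonelli_F _ _ (measurableTypeR R) _ R
  (lebesgue_tuple n) (f \o @cons_pair R n).
apply; last by move=> x; exact: f0.
exact: (measurableT_comp mf (@measurable_cons_pair R n)).
Qed.

Lemma ge0_integral_scale n (c : R) (f : n.-tuple R -> \bar R) : 0 < c ->
  measurable_fun [set: n.-tuple R] f -> (forall x, 0 <= f x)%E ->
  (\int[lebesgue_tuple n]_t f t =
   (c ^+ n)%:E * \int[lebesgue_tuple n]_t f (scale_tuple c t))%E.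
Proof.
move=> c0; elim: n f => [|n IH] f mf f0.
  rewrite expr0 mul1e; apply: eq_integral => t _.
  by congr f; rewrite tuple0 [RHS]tuple0.
rewrite ge0_integral_tupleS// [in RHS]ge0_integral_tupleS//; last first.
  exact: (measurableT_comp mf (measurable_scale_tupler c)).
have mfc : measurable_fun setT (f \o @cons_pair R n).
  exact: (measurableT_comp mf (@measurable_cons_pair R n)).
have mfx x : measurable_fun setT (fun t : n.-tuple R => f (cons_pair (x, t))).
  exact: (measurableT_comp mfc (pair1_measurable x)).
rewrite (ge0_integral_scale1 c0); last 2 first.
- exact: measurable_integral_cons.
- by move=> x; apply: integral_ge0.
rewrite exprS EFinM -muleA; congr (_ * _)%E.
rewrite -ge0_integralZl//; last 3 first.
- have mfs : measurable_fun setT (f \o scale_tuple c).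
    exact: (measurableT_comp mf (measurable_scale_tupler c)).
  by apply: (measurable_integral_cons mfs) => x; exact: f0.
- by move=> x _; apply: integral_ge0.
- by rewrite lee_fin exprn_ge0// ltW.
apply: eq_integral => x _; rewrite IH//; congr (_ * _)%E.
apply: eq_integral => t _; congr f; apply: eq_from_tnth => i.
rewrite tnth_mktuple; case: (unliftP ord0 i) => [j|] ->.
  by rewrite !tnthS tnth_mktuple.
by rewrite !(tnth_nth 0).
Qed.

End scaling.

(** * Integration along rays *)
Section rays.
Context {R : realType} (n : nat).
Notation mu := (@lebesgue_measure R).
Variable N : n.+1.-tuple R -> R.
Hypothesis mN : measurable_fun setT N.
Hypothesis N0 : forall z, 0 <= N z.
Hypothesis NZ : forall c z, 0 < c -> N (scale_tuple c z) = c * N z.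

(** At a point x with N x > 0 this is the density in t of the uniform
    probability on the interval from N x to 2 N x.  Inserting it under an
    integral over x costs nothing and creates the scale variable t. *)
Definition dyadic_weight (tx : R * n.+1.-tuple R) : R :=
  if (N tx.2 < tx.1) && (tx.1 <= 2 * N tx.2) then (N tx.2)^-1 else 0.

Lemma dyadic_weight_ge0 tx : 0 <= dyadic_weight tx.
Proof. by rewrite /dyadic_weight; case: ifP; rewrite ?invr_ge0. Qed.

Lemma measurable_dyadic_weight : measurable_fun setT dyadic_weight.
Proof.
have mN2 : measurable_fun [set: R * n.+1.-tuple R] (fun z => N z.2).
  exact: (measurableT_comp mN measurable_snd).
apply: measurable_fun_ifT => //.
- apply: measurable_and; first exact: (measurable_fun_ltr mN2 measurable_fst).
  apply: (measurable_fun_ler measurable_fst); exact: measurable_funM.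
- rewrite (_ : (fun _ => _) = (fun z : R * n.+1.-tuple R => N z.2 `^ (-1))).
    exact: (measurableT_comp (measurable_powR _) mN2).
  by apply/funext => z; rewrite powR_inv1.
Qed.

Lemma integral_dyadic_weight x : 0 < N x ->
  (\int[mu]_t (dyadic_weight (t, x))%:E = 1)%E.
Proof.
move=> Nx0.
transitivity (\int[mu]_(t in `]N x, (2 * N x)%R]) ((N x)^-1)%:E)%E.
  rewrite [RHS]integral_mkcond; apply: eq_integral => t _.
  rewrite /dyadic_weight patchE/= mem_setE in_itv/=.
  by case: ifP.
rewrite integral_cst//= lebesgue_measure_itv/= lte_fin ltr_pMl// ltr1n.
rewrite -EFinD -EFinM; congr EFin; field.
by rewrite gt_eqF.
Qed.

(** Along the dilation by t the weight at scale t becomes, up to the factor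
    1 / t, the weight at scale 1: this frees t from the space variable. *)
Lemma dyadic_weight_scale t z : 0 < t ->
  dyadic_weight (t, scale_tuple t z) = t^-1 * dyadic_weight (1, z).
Proof.
move=> t0; rewrite /dyadic_weight/= NZ// invfM.
have -> : (t * N z < t) = (N z < 1) by rewrite -{2}(mulr1 t) ltr_pM2l.
have -> : (t <= 2 * (t * N z)) = (1 <= 2 * N z).
  by rewrite mulrCA -{1}(mulr1 t) ler_pM2l.
by case: ifP => //; rewrite mulr0.
Qed.

(** Polar coordinates without a measure on the sphere.  Insert
    1 = int dyadic_weight (t, x) dt under the integral of F x, exchange the two
    integrals, substitute x = t z at fixed t, which produces the factor
    t^(n+1) / t, and exchange back.  What remains is an average over z, in the
    dyadic shell of scale 1, of one-dimensional integrals along the rays t z. *)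
Lemma ge0_integral_rays (F : n.+1.-tuple R -> R) :
  measurable_fun setT F -> (forall z, 0 <= F z) ->
  (\int[lebesgue_tuple n.+1]_(x in [set x | (0 < N x)%R]) (F x)%:E =
   \int[lebesgue_tuple n.+1]_z ((dyadic_weight (1, z))%:E *
     \int[mu]_(t in `]0%R, +oo[) (t ^+ n * F (scale_tuple t z))%:E))%E.
Proof.
move=> mF F0.
have mFs : measurable_fun [set: R * n.+1.-tuple R] (fun z => F (scale_tuple z.1 z.2)).
  exact: (measurableT_comp mF (@measurable_scale_tuple R n.+1)).
have mw1 : measurable_fun setT (fun z => dyadic_weight (1, z)).
  apply: (measurableT_comp measurable_dyadic_weight).
  exact: pair1_measurable.
pose A (tx : R * n.+1.-tuple R) := (dyadic_weight tx * F tx.2)%:E.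
pose B (tx : R * n.+1.-tuple R) :=
  (if 0 < tx.1 then
    dyadic_weight (1, tx.2) * (tx.1 ^+ n * F (scale_tuple tx.1 tx.2)) else 0)%:E.
have mA : measurable_fun setT A.
  apply/measurable_EFinP; apply: measurable_funM.
    exact: measurable_dyadic_weight.
  exact: (measurableT_comp mF measurable_snd).
have mB : measurable_fun setT B.
  apply/measurable_EFinP; apply: measurable_fun_ifT => //.
    exact: (measurable_fun_ltr (measurable_cst _) measurable_fst).
  apply: measurable_funM; first exact: (measurableT_comp mw1 measurable_snd).
  apply: measurable_funM => //.
  by apply: measurable_funX; exact: measurable_fst.
have A0 tx : (0 <= A tx)%E.
  by rewrite lee_fin mulr_ge0// dyadic_weight_ge0.
have B0 tx : (0 <= B tx)%E.
  rewrite lee_fin; case: ifP => // /ltW t0.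
  by rewrite !mulr_ge0// ?dyadic_weight_ge0// exprn_ge0.
transitivity (\int[lebesgue_tuple n.+1]_x \int[mu]_t A (t, x))%E.
  rewrite integral_mkcond; apply: eq_integral => x _.
  rewrite patchE mem_setE; case: ifPn => [Nx0|].
    under eq_integral do rewrite /A /= mulrC EFinM.
    rewrite ge0_integralZl_EFin//; last 2 first.
    - by move=> t _; rewrite lee_fin dyadic_weight_ge0.
    - apply/measurable_EFinP.
      exact: (measurableT_comp measurable_dyadic_weight (pair2_measurable x)).
    by rewrite integral_dyadic_weight// mule1.
  rewrite -leNgt => Nx0.
  rewrite integral0_eq// => t _; rewrite /A /dyadic_weight/=.
  have -> : N x = 0 by apply/le_anti; rewrite Nx0 N0.
  by rewrite invr0 if_same mul0r.
have tonelli (f : R * n.+1.-tuple R -> \bar R) :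
    measurable_fun setT f -> (forall x, 0 <= f x)%E ->
    (\int[mu]_t \int[lebesgue_tuple n.+1]_x f (t, x) =
     \int[lebesgue_tuple n.+1]_x \int[mu]_t f (t, x))%E.
  move=> mf f0.
  have := @fubini_tonelli _ _ (measurableTypeR R) _ R mu (lebesgue_tuple n.+1) f.
  exact.
rewrite -tonelli//.
transitivity (\int[mu]_t \int[lebesgue_tuple n.+1]_z B (t, z))%E.
  apply: eq_integral => t _.
  have [t0|t0] := ltP 0 t; last first.
    rewrite [LHS]integral0_eq ?[RHS]integral0_eq// => z _.
      by rewrite /B /= ltNge t0.
    by rewrite /A /dyadic_weight/= ltNge (le_trans t0)// mul0r.
  rewrite (ge0_integral_scale t0)//; last first.
    exact: (measurableT_comp mA (pair1_measurable t)).
  rewrite -ge0_integralZl_EFin//; last 2 first.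
  - have mAt : measurable_fun setT (fun x => A (t, x)).
      exact: (measurableT_comp mA (pair1_measurable t)).
    exact: (measurableT_comp mAt (measurable_scale_tupler t)).
  - by rewrite exprn_ge0// ltW.
  apply: eq_integral => z _; rewrite /A /B/= t0 dyadic_weight_scale//.
  rewrite -EFinM; congr EFin; rewrite exprSr.
  by field; rewrite gt_eqF.
rewrite tonelli//; apply: eq_integral => z _.
rewrite -ge0_integralZl_EFin//; last 3 first.
- move=> t; rewrite /= in_itv/= andbT => /ltW t0.
  by rewrite lee_fin mulr_ge0// exprn_ge0.
- apply/measurable_EFinP; apply: measurable_funTS.
  apply: measurable_funM; first exact: measurable_funX.
  exact: (measurableT_comp mFs (pair2_measurable z)).
- exact: dyadic_weight_ge0.
rewrite [RHS]integral_mkcond; apply: eq_integral => t _.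
rewrite patchE mem_setE in_itv/= andbT /B/=.
by case: ifP.
Qed.

End rays.

(** * One-dimensional substitution on the half-line *)
Section substitution.
Context {R : realType}.
Notation mu := (@lebesgue_measure R).

Lemma ge0_integral_itv0y_cvg (H : R -> R) (u : nat -> R) : continuous H ->
  (forall x, 0 <= x -> 0 <= H x) ->
  {homo u : m n / (m <= n)%N >-> m <= n} -> (forall n, n%:R <= u n) ->
  (\int[mu]_(x in `[0%R, u n]) (H x)%:E @[n --> \oo] -->
   \int[mu]_(x in `[0%R, +oo[) (H x)%:E)%E.
Proof.
move=> cH H0 ndu leu.
have -> : `[0%R, +oo[%classic = \bigcup_n `[0%R, u n]%classic :> set (measurableTypeR R).
  apply/seteqP; split => x /=.
    rewrite in_itv/= andbT => x0; exists (Num.Def.truncn x).+1 => //=.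
    rewrite in_itv/= x0 (le_trans _ (leu _))//.
    by have /andP[_ /ltW] := truncn_itv x0.
  by move=> [n _]; rewrite /= !in_itv/= andbT => /andP[].
apply: ge0_nondecreasing_set_cvg_integral => //.
- move=> m n mn; apply/subsetPset => x /=; rewrite !in_itv/= => /andP[-> /le_trans].
  by apply; exact: ndu.
- move=> n; apply/measurable_EFinP; apply: measurable_funTS.
  exact: continuous_measurable_fun.
- by move=> n x /=; rewrite in_itv/= => /andP[x0 _]; rewrite lee_fin H0.
Qed.

(** The derivative of phi is allowed to be unbounded, so the substitution is
    made on the compact intervals from 0 to n and the limit is taken on both
    sides; on the left these intervals become those from 0 to phi n, which
    exhaust the half-line because n <= phi n. *)
Lemma ge0_integral_subst0y (phi dphi G : R -> R) :
  (forall x : R, is_derive x 1 phi (dphi x)) -> continuous dphi -> continuous G ->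
  (forall x, 0 <= x -> 0 <= G x) -> (forall x, 0 <= x -> 0 <= dphi x) ->
  phi 0 = 0 -> {homo phi : x y / x < y} -> (forall x, 0 <= x -> x <= phi x) ->
  (\int[mu]_(x in `]0%R, +oo[) (G x)%:E =
   \int[mu]_(x in `]0%R, +oo[) (G (phi x) * dphi x)%:E)%E.
Proof.
move=> dfphi cdphi cG G0 dphi0 phi0 incr lephi.
have cphi : continuous phi.
  by move=> x; apply/differentiable_continuous/derivable1_diffP; apply: ex_derive.
have cGphi : continuous (fun x => G (phi x) * dphi x).
  move=> x; apply: (@continuousM _ _ (fun x => G (phi x)) dphi); last exact: cdphi.
  by apply: continuous_comp; [exact: cphi|exact: cG].
have dphiE : derive1 phi = dphi.
  by apply/funext => x; rewrite derive1E derive_val.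
have obnd (f : R -> R) : continuous f ->
    (\int[mu]_(x in `]0%R, +oo[) (f x)%:E = \int[mu]_(x in `[0%R, +oo[) (f x)%:E)%E.
  move=> cf; rewrite integral_itv_obnd_cbnd//.
  apply/measurable_EFinP; apply: measurable_funTS.
  exact: continuous_measurable_fun.
rewrite !obnd//.
have nd : {homo phi : x y / x <= y}.
  by move=> x y; rewrite le_eqVlt => /predU1P[->//|/incr/ltW].
have natle (n : nat) : (0 : R) <= n%:R by [].
have lim1 := @ge0_integral_itv0y_cvg G (fun n => phi n%:R) cG G0.
have lim2 := @ge0_integral_itv0y_cvg (fun x => G (phi x) * dphi x) (fun n => n%:R) cGphi.
apply: cvg_unique (lim1 _ _) _ => //.
- by move=> m n mn; apply: nd; rewrite ler_nat.
- by move=> n; apply: lephi.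
rewrite (_ : (fun n => _) = (fun n : nat =>
    \int[mu]_(x in `[0%R, n%:R]) (G (phi x) * dphi x)%:E)%E).
  apply: lim2 => //.
  - by move=> x x0; rewrite mulr_ge0// ?dphi0// G0// (le_trans x0)// lephi.
  - by move=> m n mn; rewrite ler_nat.
apply/funext => n; rewrite -[in LHS]phi0.
rewrite (@integration_by_substitution_increasing _ phi G)//.
- by rewrite dphiE.
- by move=> x y _ _; exact: incr.
- by rewrite dphiE => x _; exact: cdphi.
- by rewrite dphiE; apply: cvgP; apply: cvg_at_right_filter; exact: cdphi.
- by rewrite dphiE; apply: cvgP; apply: cvg_at_left_filter; exact: cdphi.
- split.
  + by move=> x _; apply: ex_derive.
  + by apply: cvg_at_right_filter; exact: cphi.
  + by apply: cvg_at_left_filter; exact: cphi.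
- exact: continuous_subspaceT.
Qed.
End substitution.

(** * Powers of the positive part *)
Section pospow.
Context {R : realType}.
Implicit Types a x : R.

(** Truncation is needed because the real power of a negative base is 1, not
    0. *)
Definition pospow a x : R := Num.max x 0 `^ a.

Lemma pospow_ge0 a x : 0 <= pospow a x. Proof. exact: powR_ge0. Qed.

Lemma pospow_le0E a x : 0 < a -> x <= 0 -> pospow a x = 0.
Proof. by move=> a0 x0; rewrite /pospow max_r// powR0// gt_eqF. Qed.

Lemma pospow_ge0E a x : 0 <= x -> pospow a x = x `^ a.
Proof. by move=> x0; rewrite /pospow max_l. Qed.

Lemma pospow_homo a : 0 <= a -> {homo pospow a : x y / x <= y}.
Proof.
move=> a0 x y xy; have m0 (z : R) : 0 <= Num.max z 0 by rewrite le_max lexx orbT.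
apply: ge0_ler_powR => //; first by rewrite nnegrE.
  by rewrite nnegrE.
by rewrite ge_max m0 andbT le_max xy.
Qed.

Lemma pospowS a x : 0 < a -> pospow a x * x = pospow (a + 1) x.
Proof.
move=> a0; have [x0|x0] := leP x 0; first by rewrite !pospow_le0E ?mul0r ?addr_gt0.
by rewrite !pospow_ge0E ?ltW// mulrC -{1}(addrK 1 a) mulr_powRB1 ?addr_gt0// ltW.
Qed.

Lemma continuous_pospow a : 0 < a -> continuous (pospow a).
Proof.
move=> a0 x; have [x0|x0|->] := ltgtP x 0.
- rewrite /continuous_at pospow_le0E ?ltW//.
  have : (cst (0 : R)) y @[y --> x] --> (0 : R) by exact: cvg_cst.
  apply: cvg_trans; apply: near_eq_cvg; near=> y; rewrite pospow_le0E//.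
  by apply/ltW; near: y; exact: lt_nbhsl.
- rewrite /continuous_at pospow_ge0E ?ltW//.
  have : (fun y => y `^ a) y @[y --> x] --> x `^ a.
    have D : is_derive x (1 : R) (fun y => y `^ a) (a * x `^ (a - 1)).
      exact: is_derive1_powR.
    by have /derivable1_diffP/differentiable_continuous := @ex_derive _ _ _ _ _ _ _ D.
  apply: cvg_trans; apply: near_eq_cvg; near=> y; rewrite pospow_ge0E//.
  by apply/ltW; near: y; exact: lt_nbhsr.
- rewrite /continuous_at (pospow_le0E a0 (lexx 0)).
  apply/cvgrPdist_lt => e e0; near=> y.
  rewrite sub0r normrN ger0_norm ?pospow_ge0//.
  have y1 : Num.max y 0 < e `^ a^-1.
    rewrite gt_max powR_gt0// andbT.
    by near: y; apply: lt_nbhsl; rewrite powR_gt0.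
  rewrite /pospow -[ltRHS](powRr1 (ltW e0)) -(@mulVf _ a) ?gt_eqF//.
  rewrite powRrM gt0_ltr_powR// nnegrE ?powR_ge0//.
  by rewrite le_max lexx orbT.
Unshelve. all: by end_near. Qed.

(** At the origin the difference quotient of the a-th power is exactly the
    (a-1)-th power, which is continuous there. *)
Lemma is_derive_pospow a x : 1 < a ->
  is_derive x (1 : R) (pospow a) (a * pospow (a - 1) x).
Proof.
move=> a1; have a0 : 0 < a by rewrite (lt_trans _ a1).
have a10 : 0 < a - 1 by rewrite subr_gt0.
have [x0|x0|->] := ltgtP x 0.
- rewrite pospow_le0E ?ltW// mulr0.
  apply: (near_eq_is_derive (f := cst 0)) => //.
  near=> y; rewrite pospow_le0E//.
  by apply/ltW; near: y; exact: lt_nbhsl.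
- rewrite pospow_ge0E ?ltW//.
  apply: (near_eq_is_derive (f := fun y => y `^ a)) => //; last exact: is_derive1_powR.
  near=> y; rewrite pospow_ge0E//.
  by apply/ltW; near: y; exact: lt_nbhsr.
- apply/is_derive1_caratheodory; exists (pospow (a - 1)); split.
  + by move=> z; rewrite (pospow_le0E a0 (lexx 0)) !subr0 pospowS// subrK.
  + exact: continuous_pospow.
  + by rewrite (pospow_le0E a10 (lexx 0)) mulr0.
Unshelve. all: by end_near. Qed.

End pospow.

(** * Euclidean geometry of row vectors *)
Section dotv_theory.
Context {R : realType} {k : nat}.
Implicit Types (u v w x : 'rV[R]_k) (c : R).

Lemma dotvC u v : dotv u v = dotv v u.
Proof. by apply: eq_bigr => i _; rewrite mulrC. Qed.

Lemma dotvDl u v w : dotv (u + v) w = dotv u w + dotv v w.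
Proof. by rewrite -big_split; apply: eq_bigr => i _; rewrite mxE mulrDl. Qed.

Lemma dotvDr u v w : dotv w (u + v) = dotv w u + dotv w v.
Proof. by rewrite dotvC dotvDl !(dotvC w). Qed.

Lemma dotvZl c u v : dotv (c *: u) v = c * dotv u v.
Proof. by rewrite /dotv mulr_sumr; apply: eq_bigr => i _; rewrite mxE mulrA. Qed.

Lemma dotvZr c u v : dotv u (c *: v) = c * dotv u v.
Proof. by rewrite dotvC dotvZl dotvC. Qed.

Lemma dotv0 u : dotv u 0 = 0.
Proof. by rewrite /dotv big1// => i _; rewrite mxE mulr0. Qed.

Lemma dot0v u : dotv 0 u = 0.
Proof. by rewrite dotvC dotv0. Qed.

Lemma dotv_ge0 u : 0 <= dotv u u.
Proof. by apply: sumr_ge0 => i _; rewrite -expr2 sqr_ge0. Qed.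

Lemma dotv_delta u i : dotv u (delta_mx ord0 i) = u ord0 i.
Proof.
rewrite /dotv (bigD1 i)//= mxE !eqxx mulr1 big1 ?addr0// => j /negbTE ji.
by rewrite mxE ji andbF mulr0.
Qed.

Lemma dotv_mulmx u v : u *m v^T = (dotv u v)%:M.
Proof.
apply/matrixP => i j; rewrite !ord1 !mxE eqxx mulr1n.
by apply: eq_bigr => l _; rewrite mxE.
Qed.

Lemma enorm_ge0 u : 0 <= enorm u. Proof. exact: sqrtr_ge0. Qed.

Lemma sqr_enorm u : enorm u ^+ 2 = dotv u u.
Proof. by rewrite sqr_sqrtr// dotv_ge0. Qed.

Lemma enormZ c u : enorm (c *: u) = `|c| * enorm u.
Proof. by rewrite /enorm dotvZl dotvZr mulrA -expr2 sqrtrM ?sqr_ge0// sqrtr_sqr. Qed.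

Lemma enorm0 : enorm (0 : 'rV[R]_k) = 0.
Proof. by rewrite /enorm dotv0 sqrtr0. Qed.

(** Differentials are taken for the sup norm while everything radial is
    Euclidean; this inequality and the next make the two norms equivalent. *)
Lemma normr_le_enorm u : `|u| <= enorm u.
Proof.
rewrite [leLHS]/Num.Def.normr/= mx_normrE.
apply: bigmax_le => [|[i j] _]; first exact: enorm_ge0.
rewrite -sqrtr_sqr/= ord1; apply: ler_wsqrtr.
rewrite /dotv (bigD1 j)//= expr2 lerDl.
by apply: sumr_ge0 => l _; rewrite -expr2 sqr_ge0.
Qed.

Lemma enorm_le_normr u : enorm u <= k%:R * `|u|.
Proof.
have H i : `|u ord0 i| <= `|u|.
  rewrite [leRHS]/Num.Def.normr/= mx_normrE.
  exact: (@le_bigmax _ _ _ _ (fun ij => `|u ij.1 ij.2|) (ord0, i)).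
rewrite -[leRHS]ger0_norm ?mulr_ge0// -sqrtr_sqr; apply: ler_wsqrtr.
rewrite exprMn; apply: (@le_trans _ _ (k%:R * `|u| ^+ 2)); last first.
  apply: ler_wpM2r; first exact: sqr_ge0.
  by rewrite -natrX ler_nat; case: (k) => // n; rewrite expnS leq_pmulr.
have -> : k%:R * `|u| ^+ 2 = \sum_(i < k) `|u| ^+ 2.
  by rewrite sumr_const card_ord mulr_natl.
apply: ler_sum => i _; rewrite -expr2 -real_normK ?num_real//.
by rewrite lerXn2r ?nnegrE.
Qed.

Lemma enorm_eq0 u : (enorm u == 0) = (u == 0).
Proof.
apply/idP/idP => [/eqP u0|/eqP ->]; last by rewrite enorm0.
by rewrite -normr_le0 -u0 normr_le_enorm.
Qed.

Lemma enorm_gt0 u : u != 0 -> 0 < enorm u.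
Proof. by rewrite -enorm_eq0 => u0; rewrite lt_def u0 enorm_ge0. Qed.

End dotv_theory.

(** * Gradients *)
Section gradients.
Context {R : realType} {k : nat}.
Implicit Types (g : 'rV[R]_k -> R) (x d : 'rV[R]_k).

(** Differentiability and the value of the gradient are carried together, so
    that one rule per operation computes both. *)
Definition is_grad g x d := is_diff x g (dotv d).

Lemma is_grad_differentiable g x d : is_grad g x d -> differentiable g x.
Proof. by case. Qed.

Lemma is_grad_diff g x d : is_grad g x d -> 'd g x = dotv d :> ('rV[R]_k -> R).
Proof. by case. Qed.

Lemma is_grad_grad g x : differentiable g x -> is_grad g x (grad g x).
Proof.
move=> dg; apply: DiffDef => //; apply/funext => v.
rewrite {1}(row_sum_delta v) linear_sum; apply: eq_bigr => i _.
by rewrite linearZ/= mxE deriveE// mulrC.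
Qed.

Lemma gradE g x d : is_grad g x d -> grad g x = d.
Proof.
move=> dg; apply/rowP => i; rewrite mxE deriveE.
  by rewrite (is_grad_diff dg) dotv_delta.
exact: is_grad_differentiable dg.
Qed.

Lemma is_grad_eq g x d d' : is_grad g x d -> d = d' -> is_grad g x d'.
Proof. by move=> + <-. Qed.

Lemma is_grad_cst (c : R) x : is_grad (cst c) x 0.
Proof.
rewrite /is_grad (_ : dotv 0 = 0); first exact: is_diff_cst.
by apply/funext => v; rewrite dot0v.
Qed.

Lemma is_gradD f g x d e :
  is_grad f x d -> is_grad g x e -> is_grad (f + g) x (d + e).
Proof.
rewrite /is_grad => df dg; rewrite (_ : dotv _ = dotv d + dotv e).
  exact: is_diffD.
by apply/funext => v; rewrite dotvDl.
Qed.

Lemma is_gradM f g x d e :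
  is_grad f x d -> is_grad g x e -> is_grad (f * g) x (f x *: e + g x *: d).
Proof.
rewrite /is_grad => df dg.
rewrite (_ : dotv _ = f x *: dotv e + g x *: dotv d).
  exact: is_diffM.
by apply/funext => v; rewrite dotvDl !dotvZl.
Qed.

Lemma is_grad_coord i x : is_grad (fun y => y ord0 i) x (delta_mx ord0 i).
Proof.
have df := differentiable_coord x ord0 i.
apply: (is_grad_eq (is_grad_grad df)); apply/rowP => j.
rewrite mxE deriveE//.
have @f : {linear 'rV[R]_k -> R}.
  by exists (fun N : 'rV[R]_k => N ord0 i); do 2![eexists]; do ?[constructor];
     rewrite ?mxE// => ? *; rewrite ?mxE//; move=> ?; rewrite !mxE.
rewrite (_ : (fun _ => _) = f :> ('rV[R]_k -> R))//.
rewrite diff_lin/=; last exact: coord_continuous.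
by rewrite !mxE eq_sym.
Qed.

Lemma is_grad_comp (phi : R -> R) g x d (l : R) :
  is_grad g x d -> is_derive (g x) (1 : R) phi l -> is_grad (phi \o g) x (l *: d).
Proof.
rewrite /is_grad => dg dphi.
have dp : differentiable phi (g x) by apply/derivable1_diffP; apply: ex_derive.
have H : is_diff (g x) phi (fun h => h *: l).
  by apply: DiffDef => //; rewrite diff1E// derive1E derive_val.
rewrite (_ : dotv _ = (fun h => h *: l) \o dotv d).
  exact: is_diff_comp.
by apply/funext => v; rewrite dotvZl /= mulrC.
Qed.

Lemma is_gradX g x d n : is_grad g x d ->
  is_grad (g ^+ n) x ((n%:R * g x ^+ n.-1) *: d).
Proof.
move=> dg; have := @is_grad_comp (fun t => t ^+ n) g x d (n%:R * g x ^+ n.-1) dg.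
rewrite (_ : _ \o _ = g ^+ n); last by apply/funext => y; rewrite /= exprfctE.
apply; split; first exact: exprn_derivable.
by rewrite exp_derive /GRing.scale/= mulr1.
Qed.

Lemma is_grad_sum n (f : 'I_n -> 'rV[R]_k -> R)
    (d : 'I_n -> 'rV[R]_k) x :
  (forall i, is_grad (f i) x (d i)) -> is_grad (\sum_i f i) x (\sum_i d i).
Proof.
move=> df; elim/big_ind2 : _ => //; first exact: is_grad_cst.
by move=> *; exact: is_gradD.
Qed.

Lemma is_grad_dotvv x : is_grad (fun y => dotv y y) x (2 *: x).
Proof.
have -> : (fun y => dotv y y) =
    \sum_i (fun y : 'rV[R]_k => y ord0 i) * (fun y => y ord0 i).
  by apply/funext => y; rewrite fct_sumE.
apply: is_grad_eq.
  by apply: is_grad_sum => i; apply: is_gradM; exact: is_grad_coord.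
rewrite {3}(row_sum_delta x) scaler_sumr; apply: eq_bigr => i _.
by rewrite scaler_nat mulr2n.
Qed.

Lemma is_grad_enorm x : x != 0 -> is_grad enorm x ((enorm x)^-1 *: x).
Proof.
move=> /enorm_gt0 x0.
have d0 : 0 < dotv x x by rewrite -sqr_enorm exprn_gt0.
apply: is_grad_eq.
  exact: (is_grad_comp (is_grad_dotvv x) (is_derive1_sqrt d0)).
rewrite scalerA -/(enorm x) invfM mulrAC mulVf ?mul1r//.
Qed.

Lemma is_grad_continuous g x d : is_grad g x d -> {for x, continuous g}.
Proof. by move=> dg; exact/differentiable_continuous/(is_grad_differentiable dg). Qed.

Lemma continuous_enorm : continuous (@enorm R k).
Proof.
move=> x; apply: (@continuous_comp _ _ _ (fun y => dotv y y) Num.sqrt).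
  exact: (is_grad_continuous (is_grad_dotvv x)).
exact: sqrt_continuous.
Qed.

End gradients.

(** * Radial profiles *)
Section radial_profile.
Context {R : realType} {k : nat} (R0 : R).
Hypothesis R0_ge0 : 0 <= R0.
Implicit Types (x : 'rV[R]_k) (a : R) (b : nat).

(** The family (|x| - R0)_+^a / |x|^b contains, up to constants, every radial
    function needed below: with f s = s + (s - R0)_+^p, the stretching factor
    f |x| / |x| is 1 + profile p 1 x and f' |x| is 1 + p * profile (p - 1) 0 x. *)
Definition profile a b x : R := pospow a (enorm x - R0) / enorm x ^+ b.

(** The derivative of the profile with respect to |x|; it stays inside the
    family. *)
Definition dprofile a b x : R := a * profile (a - 1) b x - b%:R * profile a b.+1 x.

Definition grad_profile a b x : 'rV[R]_k := (dprofile a b x / enorm x) *: x.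

Lemma profile_ge0 a b x : 0 <= profile a b x.
Proof. by rewrite divr_ge0 ?pospow_ge0// exprn_ge0// enorm_ge0. Qed.

Lemma profile0 a b : 0 < a -> profile a b 0 = 0.
Proof. by move=> a0; rewrite /profile pospow_le0E ?mul0r// enorm0 sub0r oppr_le0. Qed.

Lemma enorm_profile a b x : 0 < a -> enorm x * profile a b.+1 x = profile a b x.
Proof.
move=> a0; have [->|x0] := eqVneq x 0; first by rewrite !profile0// mulr0.
rewrite /profile exprS; field.
by rewrite expf_neq0// enorm_eq0.
Qed.

(** Since R0 is nonnegative the truncated power is at most |x|^a; this makes the
    profile vanish continuously at the origin when b < a. *)
Lemma profile_le a b x : b%:R < a -> profile a b x <= pospow (a - b%:R) (enorm x).
Proof.
move=> ba; have a0 : 0 < a by rewrite (le_lt_trans _ ba).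
have [->|x0] := eqVneq x 0; first by rewrite profile0// pospow_ge0.
have n0 := enorm_gt0 x0.
rewrite /profile ler_pdivrMr ?exprn_gt0//.
apply: (@le_trans _ _ (pospow a (enorm x))).
  by apply: pospow_homo; [exact: ltW|rewrite gerBl].
rewrite !pospow_ge0E ?enorm_ge0// -powR_mulrn ?enorm_ge0// -powRD ?subrK//.
by rewrite gt_eqF ?implybT.
Qed.

Lemma continuous_pospow_enorm a : 0 < a ->
  continuous (fun x : 'rV[R]_k => pospow a (enorm x - R0)).
Proof.
move=> a0 x; apply: (@continuous_comp _ _ _ (fun x => enorm x - R0) (pospow a)).
  exact: (cvgB (@continuous_enorm R k x) (cvg_cst R0)).
exact: continuous_pospow.
Qed.

Lemma continuous_profile a b : b%:R < a -> continuous (profile a b).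
Proof.
move=> ba; have a0 : 0 < a by rewrite (le_lt_trans _ ba).
move=> x; have [->|x0] := eqVneq x 0; last first.
  have c1 : {for x, continuous (fun x : 'rV[R]_k => enorm x ^+ b)}.
    apply: (@continuous_comp _ _ _ (@enorm R k) (fun t => t ^+ b)).
      exact: continuous_enorm.
    exact: exprn_continuous.
  have n0 : enorm x ^+ b != 0 by rewrite expf_neq0// enorm_eq0.
  exact: (cvgM (continuous_pospow_enorm a0 (x := x)) (cvgV n0 c1)).
rewrite /continuous_at profile0//.
apply: (@squeeze_cvgr _ (nbhs (0 : 'rV[R]_k)) _ R (cst 0)
  (fun x => pospow (a - b%:R) (enorm x)) (profile a b)).
- by near=> y; rewrite profile_ge0/= profile_le.
- exact: cvg_cst.
- have ab0 : 0 < a - b%:R by rewrite subr_gt0.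
  rewrite -[X in _ --> X](pospow_le0E ab0 (lexx 0)) -[X in pospow _ X](@enorm0 R k).
  apply: (@continuous_comp _ _ _ (@enorm R k)).
    exact: continuous_enorm.
  exact: continuous_pospow.
Unshelve. all: by end_near. Qed.

Lemma continuous_dprofile a b : b%:R + 1 < a -> continuous (dprofile a b).
Proof.
move=> ba x.
have h1 : b%:R < a - 1 by rewrite ltrBrDr.
have h2 : b.+1%:R < a by rewrite -natr1.
have c1 : {for x, continuous (fun x => a * profile (a - 1) b x)}.
  exact: (cvgM (cvg_cst a) (continuous_profile h1 (x := x))).
have c2 : {for x, continuous (fun x => b%:R * profile a b.+1 x)}.
  exact: (cvgM (cvg_cst _) (continuous_profile h2 (x := x))).
exact: (cvgB c1 c2).
Qed.

Lemma dprofile0 a b : 1 < a -> dprofile a b 0 = 0.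
Proof.
by move=> a1; rewrite /dprofile !profile0 ?mulr0 ?subrr ?subr_gt0// (lt_trans _ a1).
Qed.

(** The Euclidean norm is not differentiable at the origin, so the chain rule
    does not reach that point; profiles are treated there by this o(|x|) bound. *)
Lemma is_grad_at0 (f g : 'rV[R]_k -> R) :
  f 0 = 0 -> (forall x, `|f x| <= enorm x * g x) ->
  g x @[x --> (0 : 'rV[R]_k)] --> (0 : R) ->
  is_grad f 0 0.
Proof.
move=> f0 fg g0.
have cz : continuous (\0 : 'rV[R]_k -> R) by exact: cst_continuous.
have E : f \o shift 0 = cst (f 0) + (\0 : 'rV[R]_k -> R) +o_ (0 : 'rV[R]_k) id.
  apply/eqaddoP => e e0; near=> x.
  rewrite !fctE/= f0 !addr0 subr0 (le_trans (fg x))//.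
  apply: (@le_trans _ _ ((k%:R * `|x|) * (e / k.+1%:R))).
    apply: (@le_trans _ _ (enorm x * (e / k.+1%:R))).
      apply: ler_wpM2l; first exact: enorm_ge0.
      apply/ltW/(le_lt_trans (ler_norm _)); near: x.
      by apply: cvgr0_norm_lt => //; rewrite divr_gt0.
    apply: ler_wpM2r; last exact: enorm_le_normr.
    by rewrite divr_ge0 // ltW.
  have -> : k%:R * `|x| * (e / k.+1%:R) = e * `|x| * (k%:R / k.+1%:R) by ring.
  apply: ler_piMr; first by rewrite mulr_ge0// ltW.
  by rewrite ler_pdivrMr// mul1r ler_nat.
have dE : 'd f 0 = \0 :> ('rV[R]_k -> R) by exact: diff_unique.
have df : differentiable f 0 by apply/diff_locallyP; rewrite dE.
by apply: DiffDef => //; rewrite dE; apply/funext => v; rewrite dot0v.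
Unshelve. all: by end_near. Qed.

Lemma is_grad_profile_neq0 a b x : 1 < a -> x != 0 ->
  is_grad (profile a b) x (grad_profile a b x).
Proof.
move=> a1 x0; have n0 := enorm_gt0 x0.
have nz : enorm x != 0 by rewrite gt_eqF.
have d1 : is_derive (enorm x) (1 : R) (fun s => pospow a (s - R0))
    (a * pospow (a - 1) (enorm x - R0)).
  have d := @is_derive_pospow _ a (enorm x - R0) a1.
  rewrite -[X in is_derive _ _ _ X]mulr1.
  apply: (@is_derive1_comp _ (pospow a) (fun s => s - R0)).
  exact: is_derive_shift.
have d2 : is_derive (enorm x) (1 : R) (fun s => (s ^+ b)^-1)
    (- (b%:R * enorm x ^+ b.-1) / (enorm x ^+ b) ^+ 2).
  have nzb : enorm x ^+ b != 0 by rewrite expf_neq0.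
  have dX : derivable (fun s : R => s ^+ b) (enorm x) 1 by exact: exprn_derivable.
  split; first exact: derivableV.
  by rewrite deriveV// exp_derive /GRing.scale/=; field.
have g1 := is_grad_comp (is_grad_enorm x0) d1.
have g2 := is_grad_comp (is_grad_enorm x0) d2.
apply: (is_grad_eq (is_gradM g1 g2)).
rewrite /grad_profile !scalerA -scalerDl; congr (_ *: _); rewrite /dprofile /profile /=.
by case: (b) => [|c]; rewrite ?expr0/= ?exprS; field; rewrite ?expf_neq0 ?nz.
Qed.

(** At the origin the profile is |x| times the profile with b + 1, which tends
    to 0 as soon as b + 1 < a. *)
Lemma is_grad_profile a b x : b%:R + 1 < a ->
  is_grad (profile a b) x (grad_profile a b x).
Proof.
move=> ba; have a1 : 1 < a by rewrite (le_lt_trans _ ba)// lerDr.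
have a0 : 0 < a by rewrite (lt_trans _ a1).
have [->|x0] := eqVneq x 0; last exact: is_grad_profile_neq0.
rewrite /grad_profile scaler0; apply: (@is_grad_at0 _ (profile a b.+1)) => [|y|]; first exact: profile0.
  by rewrite enorm_profile// ger0_norm// profile_ge0.
rewrite -[X in _ --> X](profile0 b.+1 a0); apply: continuous_profile.
by rewrite -natr1.
Qed.

(** Near the origin the unit vector x / |x| oscillates, but its coefficient
    [dprofile] tends to 0. *)
Lemma continuous_grad_profile a b : b%:R + 1 < a ->
  continuous (grad_profile a b).
Proof.
move=> ba x; rewrite /grad_profile; have a1 : 1 < a by rewrite (le_lt_trans _ ba)// lerDr.
have cd := continuous_dprofile ba.
have [->|x0] := eqVneq x 0; last first.
  have nz : enorm x != 0 by rewrite enorm_eq0.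
  have c1 : {for x, continuous (fun x => dprofile a b x / enorm x)}.
    exact: (cvgM (cd x) (cvgV nz (@continuous_enorm R k x))).
  exact: (cvgZ c1 (@cvg_id _ (nbhs x))).
rewrite /continuous_at /= scaler0.
pose F := nbhs (0 : 'rV[R]_k); have FF : Filter F by exact: nbhs_filter.
suff : (fun x => (dprofile a b x / enorm x) *: x) @ F --> (0 : 'rV[R]_k) by [].
apply/cvgr0Pnorm_le => e e0.
have : \forall y \near (0 : 'rV[R]_k), `|dprofile a b y| <= e.
  have cd0 : dprofile a b y @[y --> (0 : 'rV[R]_k)] --> (0 : R).
    by rewrite -[X in _ --> X](dprofile0 b a1); exact: cd.
  by move/cvgr0Pnorm_le : cd0; apply.
apply: filterS => y dle.
apply: (@le_trans _ _ `|dprofile a b y|).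
  rewrite normrZ normrM normfV (ger0_norm (enorm_ge0 y)) -mulrA ler_piMr//.
  have [->|y0] := eqVneq y 0; first by rewrite normr0 mulr0.
  by rewrite mulrC ler_pdivrMr ?enorm_gt0// mul1r normr_le_enorm.
exact: dle.
Qed.

End radial_profile.

(** * Jacobian determinants of radial maps *)
Section rank_one_determinant.
Context {F : fieldType}.

(** Both sides are the determinant of the bordered matrix with rows (1, v) and
    (- u^T, c), eliminated first along its upper left and then along its lower
    right block. *)
Lemma det_scalar_addmx n (c : F) (u v : 'rV[F]_n.+1) : c != 0 ->
  \det (c%:M + u^T *m v) = c ^+ n * (c + (v *m u^T) ord0 ord0).
Proof.
move=> c0.
pose M := block_mx (1%:M : 'M[F]_1) v (- u^T) c%:M.
have E1 : block_mx (1%:M : 'M[F]_1) 0 u^T (1%:M : 'M[F]_n.+1) *m M =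
    block_mx 1%:M v 0 (c%:M + u^T *m v).
  rewrite mulmx_block !mul1mx !mul0mx !mulmx1 !addr0.
  by rewrite subrr [u^T *m v + _]addrC.
have E2 : block_mx (1%:M : 'M[F]_1) (- (c^-1 *: v)) 0 (1%:M : 'M[F]_n.+1) *m M =
    block_mx (1%:M + c^-1 *: (v *m u^T)) 0 (- u^T) c%:M.
  rewrite mulmx_block !mul1mx !mul0mx !add0r mulNmx mulmxN opprK -scalemxAl.
  by rewrite mulNmx mul_mx_scalar scalerA mulfV// scale1r subrr.
have := congr1 determinant E1; rewrite det_mulmx det_lblock det_ublock !det1 !mul1r => <-.
have := congr1 determinant E2; rewrite det_mulmx det_lblock det_ublock !det1 !mul1r => ->.
rewrite det_scalar det_mx11; set w := v *m u^T.
rewrite !mxE eqxx exprSr mulr1n.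
by field.
Qed.

End rank_one_determinant.

Section row_calculus.
Context {R : realType} {k : nat}.

Lemma is_diff_row (f : 'I_k -> 'rV[R]_k -> R) (d : 'I_k -> 'rV[R]_k) x :
  (forall i, is_grad (f i) x (d i)) ->
  is_diff x (fun y => \row_i f i y) (fun v => \row_i dotv (d i) v).
Proof.
move=> df.
have -> : (fun y => \row_i f i y) =
    \sum_i (fun y : 'rV[R]_k => f i y *: (delta_mx ord0 i : 'rV[R]_k)).
  apply/funext => y; rewrite fct_sumE [LHS]row_sum_delta.
  by apply: eq_bigr => i _; rewrite mxE.
have -> : (fun v => \row_i dotv (d i) v) =
    \sum_i (fun v : 'rV[R]_k => dotv (d i) v *: (delta_mx ord0 i : 'rV[R]_k)).
  apply/funext => y; rewrite fct_sumE [LHS]row_sum_delta.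
  by apply: eq_bigr => i _; rewrite mxE.
elim/big_ind2 : _ => [|f1 g1 f2 g2 H1 H2|i _].
- exact: is_diff_cst.
- exact: is_diffD.
- have dfi := is_grad_differentiable (df i).
  apply: DiffDef; first exact: differentiableZl.
  by rewrite diffZl// (is_grad_diff (df i)).
Qed.

Lemma continuous_dotv (T : topologicalType) (f g : T -> 'rV[R]_k) x :
  {for x, continuous f} -> {for x, continuous g} ->
  {for x, continuous (fun y => dotv (f y) (g y))}.
Proof.
move=> cf cg.
rewrite (_ : (fun y => _) = (fun y => \sum_(i < k) (f y ord0 i * g y ord0 i)))//.
apply: (@cvg_big _ _ _ _ (fun _ => true)) => [|i _].
  exact: add_continuous.
have c (h : T -> 'rV[R]_k) : {for x, continuous h} ->
    {for x, continuous (fun y => h y ord0 i)}.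
  move=> ch.
  apply: (@continuous_comp _ _ _ h (fun M : 'rV[R]_k => M ord0 i) x ch).
  exact: coord_continuous.
exact: (cvgM (c _ cf) (c _ cg)).
Qed.

End row_calculus.

(** * The radial transformation *)
Section transformation.
Context {R : realType} {k : nat} (R0 p : R).
Hypotheses (R0_ge0 : 0 <= R0) (p_gt2 : 2 < p).
Implicit Types x v : 'rV[R]_k.

Let p1_gt1 : 1 < p - 1. Proof. by rewrite ltrBrDr. Qed.
Let p1_gt0 : 0 < p - 1. Proof. exact: lt_trans p1_gt1. Qed.
Let p_gt0 : 0 < p. Proof. exact: lt_trans p_gt2. Qed.
Let p_gt1 : 1 < p. Proof. by rewrite (lt_trans _ p_gt2)// ltr1n. Qed.
Let p_gt11 : 1%:R + 1 < p. Proof. by rewrite -(natrD _ 1 1). Qed.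
Let p1_gt01 : 0%:R + 1 < p - 1. Proof. by rewrite add0r. Qed.

(** With f s = s + (s - R0)_+^p, [stretch] is f |x| / |x| and [slope] is
    f' |x|. *)
Definition stretch x : R := 1 + profile R0 p 1 x.
Definition slope x : R := 1 + p * profile R0 (p - 1) 0 x.
Definition radial_map x : 'rV[R]_k := stretch x *: x.

Lemma isotropic_radialE : isotropic (radial R0 p) = radial_map :> ('rV[R]_k -> 'rV[R]_k).
Proof.
apply/funext => x; rewrite /isotropic; case: eqVneq => [->|x0].
  by rewrite /radial_map scaler0.
rewrite /radial_map /stretch /profile /radial; congr (_ *: _).
have n0 : enorm x != 0 by rewrite enorm_eq0.
have [xR|xR] := ltP (enorm x) R0.
  by rewrite pospow_le0E// ?mul0r ?addr0 ?divff// subr_le0 ltW.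
by rewrite pospow_ge0E ?subr_ge0// mulrDl divff.
Qed.

Lemma stretch_ge1 x : 1 <= stretch x.
Proof. by rewrite lerDl profile_ge0. Qed.

Lemma slope_ge1 x : 1 <= slope x.
Proof. by rewrite lerDl mulr_ge0 ?profile_ge0// ltW. Qed.

Lemma enorm_radial_map x : enorm (radial_map x) = stretch x * enorm x.
Proof. by rewrite enormZ ger0_norm// (le_trans _ (stretch_ge1 x)). Qed.

(** This is the identity f' s = f s / s + s (f s / s)', that is, s (f s / s)
    differentiated by the product rule. *)
Lemma stretch_dprofile x : stretch x + enorm x * dprofile R0 p 1 x = slope x.
Proof.
rewrite /stretch /dprofile /slope -(enorm_profile R0_ge0 0 x p1_gt0).
by rewrite -(enorm_profile R0_ge0 1 x p_gt0); ring.
Qed.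

Lemma dotv_grad_profile a b x : dotv x (grad_profile R0 a b x) = enorm x * dprofile R0 a b x.
Proof.
rewrite dotvZr -sqr_enorm; have [->|x0] := eqVneq x 0.
  by rewrite enorm0 expr0n/= mulr0 mul0r.
by field; rewrite enorm_eq0.
Qed.

Lemma is_grad_stretch x : is_grad stretch x (grad_profile R0 p 1 x).
Proof.
rewrite (_ : stretch = cst 1 + profile R0 p 1)//.
by apply: is_grad_eq; [apply: is_gradD (is_grad_cst _ _) (is_grad_profile _ _ _)|rewrite add0r].
Qed.

Lemma is_grad_slope x : is_grad slope x (p *: grad_profile R0 (p - 1) 0 x).
Proof.
rewrite (_ : slope = cst 1 + cst p * profile R0 (p - 1) 0)//.
apply: is_grad_eq.
  apply: is_gradD (is_grad_cst _ _) _.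
  by apply: is_gradM (is_grad_cst _ _) (is_grad_profile _ _ _).
by rewrite add0r scaler0 addr0.
Qed.

Lemma is_diff_radial_map x :
  is_diff x radial_map (fun v => stretch x *: v + dotv (grad_profile R0 p 1 x) v *: x).
Proof.
have -> : radial_map = (fun y => \row_i (stretch * (fun y => y ord0 i)) y).
  by apply/funext => y; apply/rowP => i; rewrite !mxE.
have := is_diff_row (fun i => is_gradM (is_grad_stretch x) (is_grad_coord i x)).
congr is_diff_def; apply/funext => v; apply/rowP => i.
by rewrite !mxE dotvDl !dotvZl [dotv (delta_mx _ _) _]dotvC dotv_delta [x _ _ * _]mulrC.
Qed.

Lemma differentiable_radial_map x : differentiable radial_map x.
Proof. by case: (is_diff_radial_map x). Qed.

(** The differential maps v to stretch v + (v . grad stretch) x: the Jacobian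
    matrix is a rank one perturbation of a scalar matrix. *)
Lemma jacobian_radial_map x : 'J radial_map x = (stretch x)%:M + (grad_profile R0 p 1 x)^T *m x.
Proof.
apply/matrixP => i j; rewrite /jacobian mxE.
have [_ ->] := is_diff_radial_map x.
rewrite dotv_delta !mxE big_ord1 !mxE eqxx/= eq_sym.
by case: eqP => _; rewrite ?mulr1 ?mulr0 ?mulr1n ?mulr0n.
Qed.

(** The tangential directions, k - 1 in number, are stretched by f |x| / |x|
    and the radial one by f' |x|. *)
Definition jac x : R := stretch x ^+ k.-1 * slope x.

Lemma det_radial_map x : (0 < k)%N -> \det ('J radial_map x) = jac x.
Proof.
move=> k0; rewrite jacobian_radial_map.
have s0 : stretch x != 0 by rewrite gt_eqF// (lt_le_trans _ (stretch_ge1 x)).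
have : dotv x (grad_profile R0 p 1 x) = enorm x * dprofile R0 p 1 x by exact: dotv_grad_profile.
rewrite /jac -stretch_dprofile; move: (enorm x * dprofile R0 p 1 x) (grad_profile R0 p 1 x).
move: (stretch x) s0 => c c0 m; case: k k0 x => // n _ x g <-.
rewrite det_scalar_addmx// dotv_mulmx !mxE eqxx mulr1n//.
Qed.

Lemma jac_ge1 x : 1 <= jac x.
Proof.
rewrite -[leLHS]mulr1; apply: ler_pM => //; last exact: slope_ge1.
exact: exprn_ege1 (stretch_ge1 x).
Qed.

Lemma jac_gt0 x : 0 < jac x. Proof. exact: lt_le_trans (jac_ge1 x). Qed.

Definition grad_jac x : 'rV[R]_k :=
  stretch x ^+ k.-1 *: (p *: grad_profile R0 (p - 1) 0 x) +
  slope x *: ((k.-1%:R * stretch x ^+ k.-2) *: grad_profile R0 p 1 x).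

Lemma is_grad_jac x : is_grad jac x (grad_jac x).
Proof.
have -> : jac = stretch ^+ k.-1 * slope.
  by apply/funext => y; rewrite /jac !fctE.
apply: (is_grad_eq
  (is_gradM (is_gradX k.-1 (is_grad_stretch x)) (is_grad_slope x))).
by rewrite !fctE.
Qed.

Lemma transformed_densityE (pi : 'rV[R]_k -> R) : (0 < k)%N ->
  transformed_density pi (isotropic (radial R0 p)) =
  (pi \o radial_map) * jac :> ('rV[R]_k -> R).
Proof.
move=> k0; rewrite isotropic_radialE; apply/funext => x.
by rewrite /transformed_density det_radial_map// ger0_norm// ltW// jac_gt0.
Qed.

Definition grad_pullback (D : 'rV[R]_k -> 'rV[R]_k) x : 'rV[R]_k :=
  stretch x *: D (radial_map x) + dotv x (D (radial_map x)) *: grad_profile R0 p 1 x.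

Lemma is_grad_comp_radial_map (pi : 'rV[R]_k -> R) (D : 'rV[R]_k -> 'rV[R]_k) x :
  is_grad pi (radial_map x) (D (radial_map x)) -> is_grad (pi \o radial_map) x (grad_pullback D x).
Proof.
move=> dpi; have := is_diff_comp (is_diff_radial_map x) dpi.
rewrite /is_grad; congr is_diff_def; apply/funext => v.
rewrite /= dotvDl dotvDr !dotvZl !dotvZr [dotv (D _) x]dotvC; congr (_ + _).
by rewrite mulrC.
Qed.

Lemma continuous_stretch : continuous stretch.
Proof. by move=> x; exact: is_grad_continuous (is_grad_stretch x). Qed.

Lemma continuous_slope : continuous slope.
Proof. by move=> x; exact: is_grad_continuous (is_grad_slope x). Qed.

Lemma continuous_radial_map : continuous radial_map.
Proof. by move=> x; apply: differentiable_continuous; exact: differentiable_radial_map. Qed.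

Lemma continuous_grad_jac : continuous grad_jac.
Proof.
have cX n x : {for x, continuous (fun x => stretch x ^+ n)}.
  have := is_grad_continuous (is_gradX n (is_grad_stretch x)).
  by rewrite exprfctE.
move=> x.
have c1 : {for x, continuous (grad_profile R0 p 1)} by exact: continuous_grad_profile.
have c2 : {for x, continuous (grad_profile R0 (p - 1) 0)} by exact: continuous_grad_profile.
have c3 : {for x, continuous (fun x => stretch x ^+ k.-1 *: (p *: grad_profile R0 (p - 1) 0 x))}.
  exact: (cvgZ (cX k.-1 x) (cvgZ (cvg_cst p) c2)).
have c4 : {for x, continuous (fun x => k.-1%:R * stretch x ^+ k.-2)}.
  exact: (cvgM (cvg_cst _) (cX k.-2 x)).
exact: (cvgD c3 (cvgZ (@continuous_slope x) (cvgZ c4 c1))).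
Qed.

Lemma continuous_grad_pullback D : continuous D -> continuous (grad_pullback D).
Proof.
move=> cD x.
have c1 : {for x, continuous (grad_profile R0 p 1)} by exact: continuous_grad_profile.
have c2 : {for x, continuous (D \o radial_map)}.
  by apply: continuous_comp; [exact: continuous_radial_map|exact: cD].
exact: (cvgD (cvgZ (@continuous_stretch x) c2)
  (cvgZ (continuous_dotv (@cvg_id _ (nbhs x)) c2) c1)).
Qed.

(** The gradient is given by an explicit formula built from continuous maps; the
    profiles involved, (p, 1) and (p - 1, 0), both meet the requirement
    b + 1 < a exactly when 2 < p. *)
Lemma C1_transformed (pi : 'rV[R]_k -> R) : C1 pi -> C1 ((pi \o radial_map) * jac).
Proof.
move=> [dpi cpi].
have H x : is_grad ((pi \o radial_map) * jac) x
    (pi (radial_map x) *: grad_jac x + jac x *: grad_pullback (grad pi) x).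
  apply: is_gradM (is_grad_jac x).
  by apply: is_grad_comp_radial_map; exact: is_grad_grad.
split=> [x|]; first exact: is_grad_differentiable (H x).
have -> : grad ((pi \o radial_map) * jac) = (fun x =>
  pi (radial_map x) *: grad_jac x + jac x *: grad_pullback (grad pi) x).
  by apply/funext => x; exact: gradE.
move=> x.
have c1 : {for x, continuous (pi \o radial_map)}.
  apply: continuous_comp; first exact: continuous_radial_map.
  exact: differentiable_continuous.
have c2 : {for x, continuous jac} := is_grad_continuous (is_grad_jac x).
exact: (cvgD (cvgZ c1 (@continuous_grad_jac x)) (cvgZ c2 (@continuous_grad_pullback _ cpi x))).
Qed.

End transformation.

(** * Total mass of the transformed density *)
Section measurability.
Context {R : realType} {k : nat} (R0 p : R).
Implicit Types t z : k.-tuple R.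

Lemma rV_of_tuple_scale c t : rV_of_tuple (scale_tuple c t) = c *: rV_of_tuple t.
Proof. by apply/rowP => i; rewrite !mxE tnth_mktuple. Qed.

Lemma measurable_enorm : measurable_fun setT (fun t => enorm (rV_of_tuple t)).
Proof.
have ms : measurable_fun [set: R] (@Num.sqrt R).
  by apply: continuous_measurable_fun; exact: sqrt_continuous.
have md : measurable_fun setT (fun t : k.-tuple R => \sum_(i < k) tnth t i * tnth t i).
  apply: measurable_sum => i.
  by apply: measurable_funM; exact: measurable_tnth.
rewrite (_ : (fun _ => _) = Num.sqrt \o (fun t : k.-tuple R =>
    \sum_(i < k) tnth t i * tnth t i)); first exact: (measurableT_comp ms md).
apply/funext => t; rewrite /enorm /dotv /=; congr Num.sqrt.
by apply: eq_bigr => i _; rewrite !mxE.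
Qed.

Lemma measurable_profile a b : measurable_fun setT (fun t => profile R0 a b (rV_of_tuple t)).
Proof.
rewrite (_ : (fun _ => _) = (fun t =>
    Num.max (enorm (rV_of_tuple t) - R0) 0 `^ a *
    (enorm (rV_of_tuple t) ^+ b) `^ (-1))); last first.
  (* The inverse is written as a power, whose measurability is known. *)
  by apply/funext => t; rewrite powR_inv1// exprn_ge0// enorm_ge0.
apply: measurable_funM; apply: (measurableT_comp (measurable_powR _)).
  apply: measurable_maxr => //; apply: measurable_funB => //.
  exact: measurable_enorm.
by apply: measurable_funX; exact: measurable_enorm.
Qed.

(** The map [radial_map] scales a tuple by a measurable factor, so composing with it
    preserves measurability for the product sigma-algebra on tuples. *)
Lemma measurable_transformed (pi : 'rV[R]_k -> R) :
  measurable_fun setT (pi \o rV_of_tuple) ->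
  measurable_fun setT (((pi \o radial_map R0 p) * jac R0 p) \o rV_of_tuple).
Proof.
move=> mpi.
have ms : measurable_fun setT (fun t => stretch R0 p (rV_of_tuple t)).
  by apply: measurable_funD => //; exact: measurable_profile.
have mh : measurable_fun setT
    (fun t => scale_tuple (stretch R0 p (rV_of_tuple t)) t).
  exact: (measurableT_comp (@measurable_scale_tuple R k)
    (measurable_fun_pair ms (@measurable_id _ _ _))).
apply: measurable_funM.
  rewrite (_ : (fun _ => _) = (pi \o rV_of_tuple) \o
      (fun t => scale_tuple (stretch R0 p (rV_of_tuple t)) t)); last first.
    by apply/funext => t; rewrite /= rV_of_tuple_scale.
  exact: measurableT_comp mpi mh.
apply: measurable_funM; first exact: measurable_funX.
apply: measurable_funD => //; apply: measurable_funM => //.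
exact: measurable_profile.
Qed.

Lemma lebesgue_tuple_enorm0 : (0 < k)%N ->
  @lebesgue_tuple R k [set t | enorm (rV_of_tuple t) = 0] = 0%E.
Proof.
move=> k0.
have -> : [set t : k.-tuple R | enorm (rV_of_tuple t) = 0] =
    [set t | forall i, [set (0 : R)] (tnth t i)].
  apply/seteqP; split => t /=.
    by move=> /eqP; rewrite enorm_eq0 => /eqP/rowP t0 i; have := t0 i; rewrite !mxE.
  move=> t0; apply/eqP; rewrite enorm_eq0; apply/eqP/rowP => i; rewrite !mxE.
  exact: t0.
rewrite (@lebesgue_tuple_box R k (fun _ => [set (0 : R)]))//.
case: k k0 => // n _; rewrite big_ord_recl lebesgue_measure_set1 mul0e//.
Qed.

Lemma integral_enorm_gt0 (F : k.-tuple R -> R) : (0 < k)%N ->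
  measurable_fun setT F -> (forall t, 0 <= F t) ->
  (\int[lebesgue_tuple k]_t (F t)%:E =
   \int[lebesgue_tuple k]_(t in [set t | (0 < enorm (rV_of_tuple t))%R]) (F t)%:E)%E.
Proof.
move=> k0 mF F0.
have mN0 : measurable [set t : k.-tuple R | enorm (rV_of_tuple t) = 0].
  have := measurable_enorm measurableT (measurable_set1 (0 : R)).
  by rewrite setTI.
rewrite (ge0_negligible_integral mN0)//.
- congr (integral _ _ _); apply/seteqP; split => t /=.
    move=> [_ /eqP]; rewrite lt_def enorm_ge0 andbT//.
  by move=> t0; split => // /eqP; rewrite gt_eqF.
- exact/measurable_EFinP.
- by move=> t _; rewrite lee_fin.
- exact: lebesgue_tuple_enorm0.
Qed.

End measurability.

Section total_mass.
Context {R : realType} {n : nat} (R0 p : R).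
Hypotheses (R0_ge0 : 0 <= R0) (p_gt2 : 2 < p).
Notation mu := (@lebesgue_measure R).
Notation k := n.+1.

Let p1_gt1 : 1 < p - 1. Proof. by rewrite ltrBrDr. Qed.
Let p1_gt0 : 0 < p - 1. Proof. exact: lt_trans p1_gt1. Qed.
Let p_gt0 : 0 < p. Proof. exact: lt_trans p_gt2. Qed.
Let p_gt1 : 1 < p. Proof. by rewrite (lt_trans _ p_gt2)// ltr1n. Qed.

(** On the ray through x the radial map is the substitution u = phi t, where
    phi t = f (t |x|) / |x|.  The tangential part of the Jacobian determinant
    turns t^n into (phi t)^n and its radial part is phi' t. *)
Lemma integral_ray (pi : 'rV[R]_k -> R) (x : 'rV[R]_k) :
  continuous pi -> (forall y, 0 <= pi y) -> x != 0 ->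
  (\int[mu]_(t in `]0%R, +oo[) (t ^+ n * pi (t *: x))%:E =
   \int[mu]_(t in `]0%R, +oo[)
     (t ^+ n * ((pi \o radial_map R0 p) * jac R0 p) (t *: x))%:E)%E.
Proof.
move=> cpi pi0 x0; have r0 := enorm_gt0 x0; set r := enorm x in r0.
pose phi (t : R) := t + r^-1 * pospow p (t * r - R0).
pose dphi (t : R) := 1 + p * pospow (p - 1) (t * r - R0).
have nd : {homo (fun t : R => r^-1 * pospow p (t * r - R0)) : s t / s <= t}.
  move=> s t st; rewrite ler_pM2l ?invr_gt0//; apply: pospow_homo; first exact: ltW.
  by rewrite lerD2r ler_pM2r.
have daff (t : R) : is_derive t (1 : R) (fun t : R => t * r - R0) r.
  apply/is_derive1_caratheodory; exists (cst r); split=> //=.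
    by move=> z; ring.
  exact: cvg_cst.
have caff : continuous (fun t : R => t * r - R0).
  by move=> t; apply/differentiable_continuous/derivable1_diffP; case: (daff t).
have dphiP (t : R) : is_derive t (1 : R) phi (dphi t).
  have d1 : is_derive t (1 : R) (pospow p \o (fun t : R => t * r - R0))
      (p * pospow (p - 1) (t * r - R0) * r).
    by apply: is_derive1_comp; exact: is_derive_pospow.
  have := is_deriveD (is_derive_id t (1 : R)) (is_deriveZ r^-1 d1).
  move/is_derive_eq; apply.
  by rewrite /dphi /GRing.scale/=; congr (1 + _); field; rewrite gt_eqF.
rewrite (@ge0_integral_subst0y R phi dphi (fun t => t ^+ n * pi (t *: x)))//.
- apply: eq_integral => t; rewrite inE/= in_itv/= andbT => t0; congr EFin.
  have tx : enorm (t *: x) = t * r by rewrite enormZ gtr0_norm.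
  have phiE : phi t = stretch R0 p (t *: x) * t.
    rewrite /phi /stretch /profile tx expr1; field.
    by rewrite !gt_eqF.
  rewrite fctE/= /jac/= /radial_map scalerA -phiE.
  have -> : slope R0 p (t *: x) = dphi t.
    by rewrite /slope /profile tx expr0 divr1.
  by rewrite phiE exprMn; ring.
- move=> t; have c1 : {for t, continuous (fun t : R => pospow (p - 1) (t * r - R0))}.
    by apply: continuous_comp; [exact: caff|exact: continuous_pospow].
  exact: (cvgD (cvg_cst (1 : R)) (cvgM (cvg_cst p) c1)).
- move=> t; have c1 : {for t, continuous (fun t : R => pi (t *: x))}.
    apply: continuous_comp; last exact: cpi.
    exact: (cvgZ (@cvg_id _ (nbhs t)) (cvg_cst x)).
  exact: (cvgM (@exprn_continuous _ n t) c1).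
- by move=> t t0; rewrite mulr_ge0// exprn_ge0.
- by move=> t t0; rewrite addr_ge0// mulr_ge0 ?pospow_ge0// ltW.
- by rewrite /phi mul0r sub0r pospow_le0E ?oppr_le0// mulr0 addr0.
- by move=> s t st; apply: ltr_leD => //; apply: nd; exact: ltW.
- by move=> t t0; rewrite lerDl mulr_ge0 ?pospow_ge0// invr_ge0 ltW.
Qed.

(** By integration along rays the change of variables reduces to the one on each
    ray; the origin, where rays are not defined, is negligible. *)
Lemma integral_transformed (pi : 'rV[R]_k -> R) :
  continuous pi -> (forall y, 0 <= pi y) ->
  measurable_fun setT (pi \o @rV_of_tuple R k) ->
  (\int[lebesgue_tuple k]_t (((pi \o radial_map R0 p) * jac R0 p) (rV_of_tuple t))%:E =
   \int[lebesgue_tuple k]_t (pi (rV_of_tuple t))%:E)%E.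
Proof.
move=> cpi pi0 mpi.
have mT := measurable_transformed R0 p mpi.
have T0 t : 0 <= (((pi \o radial_map R0 p) * jac R0 p) \o rV_of_tuple) t.
  by apply: mulr_ge0; [exact: pi0|apply/ltW; exact: jac_gt0].
have hom c (t : k.-tuple R) : 0 < c ->
    enorm (rV_of_tuple (scale_tuple c t)) = c * enorm (rV_of_tuple t).
  by move=> c0; rewrite rV_of_tuple_scale enormZ gtr0_norm.
have en0 (t : k.-tuple R) : 0 <= enorm (rV_of_tuple t) by exact: enorm_ge0.
rewrite [LHS](integral_enorm_gt0 (ltn0Sn n) mT T0).
rewrite [RHS](integral_enorm_gt0 (ltn0Sn n) mpi (fun t => pi0 (rV_of_tuple t))).
rewrite (ge0_integral_rays (@measurable_enorm R k) en0 hom mT T0).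
rewrite (ge0_integral_rays (@measurable_enorm R k) en0 hom mpi) => [|t]; last exact: pi0.
apply: eq_integral => z _.
have [z0|z0] := eqVneq (rV_of_tuple z) 0.
  rewrite /dyadic_weight/= z0 enorm0 mulr0.
  by rewrite [1 <= 0]leNgt ltr01 andbF !mul0e.
congr (_ * _)%E.
under eq_integral do rewrite /= rV_of_tuple_scale.
under [RHS]eq_integral do rewrite /= rV_of_tuple_scale.
by rewrite -integral_ray.
Qed.

End total_mass.

(** * Tails *)
Section tails.
Context {R : realType} {k : nat} (R0 p : R).
Hypotheses (R0_ge0 : 0 <= R0) (p_gt2 : 2 < p).
Implicit Types (x : 'rV[R]_k) (pi : 'rV[R]_k -> R).

Let p1_gt1 : 1 < p - 1. Proof. by rewrite ltrBrDr. Qed.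
Let p1_gt0 : 0 < p - 1. Proof. exact: lt_trans p1_gt1. Qed.
Let p_gt0 : 0 < p. Proof. exact: lt_trans p_gt2. Qed.
Let p_gt1 : 1 < p. Proof. by rewrite (lt_trans _ p_gt2)// ltr1n. Qed.

(** Outside some ball the supremum is negative; when it is -oo, any d, here 1,
    will do. *)
Lemma dlog_limsup_lt0 (g : 'rV[R]_k -> R) : (dlog_limsup g < 0)%E ->
  exists2 d : R, 0 < d & exists r : R, forall x, r < enorm x ->
    dotv ((enorm x)^-1 *: x) (grad (fun y => ln (g y)) x) <= - d.
Proof.
rewrite /dlog_limsup limf_esupE => /ereal_inf_lt[_ [A [r Ar] <-]] supA0.
have ub x : r < enorm x ->
    ((dotv ((enorm x)^-1 *: x) (grad (fun y => ln (g y)) x))%:E <=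
     ereal_sup ((fun x => (dotv ((enorm x)^-1 *: x)
       (grad (fun y => ln (g y)) x))%:E) @` A))%E.
  by move=> /Ar Ax; apply: ereal_sup_ubound; exists x.
move: supA0 ub; case: (ereal_sup _) => [c|//|].
- rewrite lte_fin => c0 ub; exists (- c); first by rewrite oppr_gt0.
  by exists r => x /ub; rewrite lee_fin opprK.
- by move=> _ ub; exists 1 => //; exists r => x /ub; rewrite leeNy_eq.
Qed.

Lemma dlog_limsup_Ny (g : 'rV[R]_k -> R) :
  (forall M : R, exists r : R, forall x, r < enorm x ->
    dotv ((enorm x)^-1 *: x) (grad (fun y => ln (g y)) x) <= M) ->
  dlog_limsup g = -oo%E.
Proof.
move=> H; apply: eq_ninfty => M; rewrite /dlog_limsup limf_esupE.
have [r Hr] := H M.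
apply: ge_ereal_inf; eexists.
  by exists [set x | r < enorm x] => //; exists r.
by apply: ge_ereal_sup => _ [x rx <-]; rewrite lee_fin; exact: Hr.
Qed.

Lemma grad_ln (g : 'rV[R]_k -> R) x d : 0 < g x -> is_grad g x d ->
  grad (fun y => ln (g y)) x = (g x)^-1 *: d.
Proof. by move=> g0 dg; apply: gradE; exact: (is_grad_comp dg (is_derive1_ln g0)). Qed.

(** The direction of x is an eigendirection of the differential at x, and the
    eigenvalue is the slope by [stretch_dprofile]. *)
Lemma dotv_grad_pullback D x :
  dotv x (grad_pullback R0 p D x) = slope R0 p x * dotv x (D (radial_map R0 p x)).
Proof.
rewrite /grad_pullback dotvDr -stretch_dprofile// -dotv_grad_profile.
move: (grad_profile _ _ _ _) (D _) => g d.
by rewrite !dotvZr; ring.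
Qed.

Lemma dotv_grad_jac x : dotv x (grad_jac R0 p x) =
  stretch R0 p x ^+ k.-1 * (p * (enorm x * dprofile R0 (p - 1) 0 x)) +
  slope R0 p x * (k.-1%:R * stretch R0 p x ^+ k.-2 * (enorm x * dprofile R0 p 1 x)).
Proof.
rewrite /grad_jac -!dotv_grad_profile.
move: (grad_profile _ _ _ _) (grad_profile _ _ _ _) => g d.
by rewrite dotvDr !dotvZr.
Qed.

(** The radial derivative of log (pi (h x)) + log (f' s) +
    (k - 1) log (f s / s), with s = |x|: the first term gives the radial
    derivative of log pi at h x, times f' s, because h x has the same direction
    as x. *)
Lemma radial_dlog_transformed pi x : (forall y, 0 < pi y) ->
  (forall y, differentiable pi y) -> x != 0 ->
  dotv ((enorm x)^-1 *: x) (grad (fun y => ln (((pi \o radial_map R0 p) * jac R0 p) y)) x) =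
  slope R0 p x * dotv ((enorm (radial_map R0 p x))^-1 *: radial_map R0 p x)
    (grad (fun y => ln (pi y)) (radial_map R0 p x)) +
  p * dprofile R0 (p - 1) 0 x / slope R0 p x +
  k.-1%:R * dprofile R0 p 1 x / stretch R0 p x.
Proof.
move=> pi0 dpi x0.
have T0 : 0 < ((pi \o radial_map R0 p) * jac R0 p) x.
  by apply: mulr_gt0; [exact: pi0|exact: jac_gt0].
have A0 : stretch R0 p x != 0.
  by rewrite gt_eqF// (lt_le_trans _ (stretch_ge1 _ _ x)).
have B0 : slope R0 p x != 0.
  by rewrite gt_eqF// (lt_le_trans _ (slope_ge1 _ p_gt2 x)).
have s0 : enorm x != 0 by rewrite enorm_eq0.
have dT := is_gradM
  (is_grad_comp_radial_map R0_ge0 p_gt2 (is_grad_grad (dpi (radial_map R0 p x))))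
  (is_grad_jac R0_ge0 p_gt2 x).
rewrite (grad_ln T0 dT) (grad_ln (pi0 _) (is_grad_grad (dpi _))).
have -> : (enorm (radial_map R0 p x))^-1 *: radial_map R0 p x = (enorm x)^-1 *: x.
  by rewrite enorm_radial_map /radial_map scalerA invfM mulrAC mulVf// mul1r.
move: (dotv_grad_pullback (grad pi) x) (dotv_grad_jac x) T0 (pi0 (radial_map R0 p x)).
rewrite !fctE/=; move: (grad_pullback _ _ _ _) (grad_jac _ _ _) (grad pi _) (pi _) => g1 g2 g3 q.
rewrite !dotvZl !dotvZr dotvDr !dotvZr => -> -> _ q0; rewrite /jac.
case: (k.-1) => [|m] /=.
  by rewrite !expr0 mulr0n; field; rewrite A0 B0 s0 gt_eqF.
by rewrite exprS; field; rewrite A0 B0 s0 gt_eqF// expf_neq0.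
Qed.

(** f'' s / f' s is bounded: for s - R0 >= 1 a power of s - R0 with smaller
    exponent is smaller, and the constant 1 in f' only helps. *)
Lemma dprofile_slope_le x : 1 <= enorm x - R0 ->
  p * dprofile R0 (p - 1) 0 x / slope R0 p x <= p - 1.
Proof.
move=> m1; have m0 : 0 <= enorm x - R0 by rewrite (le_trans _ m1).
rewrite ler_pdivrMr; last by rewrite (lt_le_trans _ (slope_ge1 _ p_gt2 x)).
rewrite /dprofile mul0r subr0 /slope /profile expr0 !divr1 !pospow_ge0E//.
have : (enorm x - R0) `^ (p - 1 - 1) <= (enorm x - R0) `^ (p - 1).
  by apply: ler_powR => //; rewrite gerBl.
have : 0 <= (enorm x - R0) `^ (p - 1) by exact: powR_ge0.
move: (_ `^ (p - 1)) (_ `^ (p - 1 - 1)) => u v u0 vu.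
have : p * (p - 1) * v <= p * (p - 1) * u by rewrite ler_pM2l ?mulr_gt0.
by have := ltW p1_gt0; nra.
Qed.

(** The logarithmic derivative of f s / s is bounded, by the same comparison of
    exponents. *)
Lemma dprofile_stretch_le x : 1 <= enorm x - R0 ->
  dprofile R0 p 1 x / stretch R0 p x <= p.
Proof.
move=> m1; have m0 : 0 <= enorm x - R0 by rewrite (le_trans _ m1).
rewrite ler_pdivrMr; last by rewrite (lt_le_trans _ (stretch_ge1 _ _ x)).
apply: (@le_trans _ _ (p * profile R0 (p - 1) 1 x)).
  by rewrite /dprofile gerBl mul1r profile_ge0.
rewrite ler_pM2l// /stretch (@le_trans _ _ (profile R0 p 1 x)) ?lerDr//.
rewrite /profile ler_pM2r ?invr_gt0 ?expr1; last first.
  by rewrite (lt_le_trans (lt_le_trans ltr01 m1))// gerBl.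
by rewrite !pospow_ge0E//; apply: ler_powR => //; rewrite gerBl.
Qed.

Lemma slope_ge x : 1 <= enorm x - R0 -> enorm x - R0 <= slope R0 p x.
Proof.
move=> m1; have m0 : 0 <= enorm x - R0 by rewrite (le_trans _ m1).
rewrite /slope /profile expr0 divr1 pospow_ge0E//.
have : enorm x - R0 <= (enorm x - R0) `^ (p - 1) by apply: le1r_powR; rewrite // ltW.
have : (enorm x - R0) `^ (p - 1) <= p * (enorm x - R0) `^ (p - 1).
  by rewrite ler_peMl ?powR_ge0// ltW.
lra.
Qed.

(** For |x| >= R0 + 1 the slope is at least |x| - R0, so the main term, at most
    - d (|x| - R0), beats the bounded ones. *)
Lemma dlog_limsup_transformed pi : (forall y, 0 < pi y) ->
  (forall y, differentiable pi y) -> (dlog_limsup pi < 0)%E ->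
  dlog_limsup ((pi \o radial_map R0 p) * jac R0 p) = -oo%E.
Proof.
move=> pi0 dpi /dlog_limsup_lt0[d d0 [r Hr]].
apply: dlog_limsup_Ny => M.
(* C bounds the two terms that come from the Jacobian determinant. *)
pose C := p - 1 + k.-1%:R * p.
exists (Num.max (R0 + 1) (Num.max r (R0 + (C - M) / d))) => x.
rewrite !gt_max => /and3P[xR xr xM].
have m1 : 1 <= enorm x - R0 by rewrite lerBrDl ltW.
have x0 : x != 0 by rewrite -enorm_eq0 gt_eqF// (le_lt_trans _ xR)// addr_ge0.
rewrite radial_dlog_transformed//.
have hr : r < enorm (radial_map R0 p x).
  by rewrite enorm_radial_map (lt_le_trans xr)// ler_peMl ?enorm_ge0// stretch_ge1.
have := Hr _ hr; move: (dotv _ _) => e ed.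
have h1 := dprofile_slope_le m1.
have h2 : k.-1%:R * dprofile R0 p 1 x / stretch R0 p x <= k.-1%:R * p.
  by rewrite -mulrA ler_wpM2l// dprofile_stretch_le.
have h3 := slope_ge m1.
have h4 : C - M <= (enorm x - R0) * d by rewrite -ler_pdivrMr// lerBrDl ltW.
have h5 : slope R0 p x * e <= (enorm x - R0) * - d.
  apply: (@le_trans _ _ (slope R0 p x * - d)).
    by rewrite ler_wpM2l// (le_trans _ h3)// (le_trans _ m1).
  by rewrite ler_nM2r// oppr_lt0.
rewrite /C in h4; lra.
Qed.

End tails.

Theorem theorem2 (R : realType) (k : nat) (hk : (1 <= k)%N)
    (pi_beta : 'rV[R]_k -> R) (hpi : exponentially_light pi_beta)
    (R0 p : R) (hR0 : 0 <= R0) (hp : 2 < p) :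
  super_exponentially_light
    (transformed_density pi_beta (isotropic (radial R0 p))).
Proof.
have [[[pi_ge0 mpi int1] pi_gt0 C1pi] limpi] := hpi.
have [dpi _] := C1pi.
have cpi : continuous pi_beta by move=> x; exact: differentiable_continuous.
rewrite (transformed_densityE hR0 hp _ hk).
split; last exact: dlog_limsup_transformed.
have T_gt0 x : 0 < ((pi_beta \o radial_map R0 p) * jac R0 p) x.
  by apply: mulr_gt0; [exact: pi_gt0|exact: jac_gt0].
split; [|exact: T_gt0|exact: C1_transformed].
split=> [x||]; first exact: ltW.
- exact: measurable_transformed.
- rewrite -int1; clear hpi limpi C1pi T_gt0 int1 pi_gt0 dpi.
  case: k hk pi_beta pi_ge0 mpi cpi => // n _ pi pi_ge0 mpi cpi.
  exact: integral_transformed.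
Qed.
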